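(* Let $X^f(t)=B(S^f(t))$, $t\ge0$, where $B$ is a standard one-dimensional Brownian motion and $S^f$ is an inverse subordinator independent of $B$. Then \[ \lim_{t\to\infty}\frac{X^f(t)}{t}=0\quad\text{a.s.} \]
   Context: $T^f=(T^f(t))_{t\ge 0}$ is a subordinator (an increasing Lévy process with right-continuous paths with left limits, $T^f(0)=0$) with $\mathbb{E}(e^{-uT^f(t)})=e^{-tf(u)}$, where $f(u)=\int_{(0,\infty)}(1-e^{-ux})\,\nu(dx)$ (zero drift), and $\nu$ is a measure on $(0,\infty)$ with $\int_{(0,\infty)}\min\{1,x\}\,\nu(dx)<\infty$ and $\nu(0,\infty)=\infty$. The inverse subordinator is $S^f(t)=\inf\{\tau>0:T^f(\tau)>t\}$, $t\ge0$. *)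

(* Defs.v *)
From HB Require Import structures.
From mathcomp Require Export all_boot all_order all_algebra.
From mathcomp Require Export all_classical all_reals all_analysis.

Set Implicit Arguments.
Unset Strict Implicit.
Unset Printing Implicit Defensive.

Export Order.TTheory GRing.Theory Num.Theory.
Export numFieldNormedType.Exports.

Local Open Scope classical_set_scope.
Local Open Scope ring_scope.

(* MathComp-Analysis.  A process on [0, +oo[ is a family indexed by R of which
   only the restriction to nonnegative times is ever constrained or used. *)

Section processes.
Context {d : measure_display} {Omega : measurableType d} {R : realType}.

Definition process_sigma_algebra (X : R -> Omega -> R) : set (set Omega) :=
  <<s \bigcup_(t in `[0, +oo[) preimage_set_system setT (X t) measurable >>.

Definition independent_processes (P : probability Omega R)
    (X Y : R -> Omega -> R) : Prop :=
  forall A C : set Omega,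
    process_sigma_algebra X A -> process_sigma_algebra Y C ->
    P (A `&` C) = (P A * P C)%E.

(* Taking some of the A i equal to setT gives the product rule for every
   subfamily of the increments. *)
Definition independent_increments (P : probability Omega R)
    (X : R -> Omega -> R) : Prop :=
  forall (n : nat) (t : nat -> R) (A : nat -> set R),
    0 <= t 0%N -> (forall i, t i <= t i.+1) ->
    (forall i, measurable (A i)) ->
    P (\bigcap_(i in `I_n) [set w | A i (X (t i.+1) w - X (t i) w)]) =
    (\prod_(i < n) P [set w | A i (X (t i.+1) w - X (t i) w)%R])%E.

Definition stationary_increments (P : probability Omega R)
    (X : R -> Omega -> R) : Prop :=
  forall (s t : R) (A : set R), 0 <= s -> s <= t -> measurable A ->
    P [set w | A (X t w - X s w)] = P [set w | A (X (t - s) w - X 0 w)].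

(* The second parameter of normal_prob is the standard deviation. *)
Record standard_brownian_motion (P : probability Omega R)
    (B : R -> {RV P >-> R}) : Prop := {
  bm_start : {ae P, forall w, B 0 w = 0} ;
  bm_indep : independent_increments P B ;
  bm_gauss : forall (s t : R) (A : set R), 0 <= s -> s < t -> measurable A ->
    P [set w | A (B t w - B s w)] = normal_prob 0 (Num.sqrt (t - s)) A ;
  bm_cont : {ae P, forall w,
    {within `[0, +oo[, continuous (fun t : R => B t w)}} }.

(* nu is a measure on ]0, +oo[: its values outside play no role. *)
Definition infinite_levy_measure (nu : {measure set R -> \bar R}) : Prop :=
  (\int[nu]_(x in `]0%R, +oo[) (Num.min 1 x)%:E < +oo)%E /\
  nu `]0%R, +oo[%classic = +oo%E.

Definition laplace_exponent (nu : {measure set R -> \bar R}) (u : R) : R :=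
  \int[nu]_(x in `]0, +oo[) (1 - expR (- (u * x))).

Record subordinator (P : probability Omega R)
    (nu : {measure set R -> \bar R}) (T : R -> {RV P >-> R}) : Prop := {
  sub_start : forall w, T 0 w = 0 ;
  sub_incr : forall w (s t : R), 0 <= s -> s <= t -> T s w <= T t w ;
  sub_rcont : forall w (t : R), 0 <= t -> T s w @[s --> t^'+] --> T t w ;
  sub_llim : forall w (t : R), 0 < t -> cvg (T s w @[s --> t^'-]) ;
  sub_indep : independent_increments P T ;
  sub_stat : stationary_increments P T ;
  sub_laplace : forall u t : R, 0 <= u -> 0 <= t ->
    ('E_P[fun w => expR (- (u * T t w))] =
     (expR (- (t * laplace_exponent nu u)))%:E)%E }.

(* The infimum is over a nonempty set unless the path of T is bounded by t, an
   event of probability 0 for a subordinator with infinite Levy measure. *)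
Definition inverse_process (T : R -> Omega -> R) (t : R) (w : Omega) : R :=
  inf [set tau : R | 0 < tau /\ t < T tau w].

End processes.

(* Main.v *)
Require Import Defs.
From mathcomp Require Import measurable_realfun ring lra.

Set Implicit Arguments.
Unset Strict Implicit.
Unset Printing Implicit Defensive.

Local Open Scope classical_set_scope.
Local Open Scope ring_scope.

(* Two almost sure growth bounds suffice: S(t) = O(t) for the inverse process S,
   and a sublinear running maximum for |B|.  First, by Chernoff and the Laplace
   transform at 1, P(T(cn) <= n+1) <= exp(n+1 - c n f(1)), which is summable for
   c = 2 / f(1); by Borel-Cantelli S(t) <= c t for all large t.  Second,
   dyadic chaining on [0, 2^m] with the threshold (3/2)^m (9/10)^k at mesh
   2^(m-k), together with Gaussian tails and Borel-Cantelli, gives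
   sup_[0, 2^m] |B| = O((3/2)^m), so the running maximum of |B| is sublinear. *)

(** * Gaussian tails *)

Lemma measurable_gt_norm (R : realType) (a : R) :
  measurable [set x : R | a < `|x|].
Proof.
rewrite -[X in measurable X]setTI.
apply: (@normr_measurable R setT measurableT [set y | a < y]).
by apply: open_measurable; exact: open_gt.
Qed.

(** The Gaussian decay is traded for a fourth power of [s / a]: this suffices for geometric series
    and becomes rational in the variance for Brownian increments. *)
Lemma normal_tail (R : realType) (s a : R) : 0 < s -> 0 < a ->
  (normal_prob 0 s [set x | (a < `|x|)%R] <= (29 * (s / a) ^+ 4)%:E)%E.
Proof.
move=> s0 a0.
(* The gap [a^2 / (2 s^2) - a^2 / (8 s^2)] between the exponents for deviations [s] and [2 * s]. *)
set y := 3 * a ^+ 2 / (8 * s ^+ 2).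
have y0 : 0 < y by rewrite /y divr_gt0 // mulr_gt0 ?exprn_gt0.
have mA := measurable_gt_norm a.
(* Outside [-a, a], the density is compared with that of standard deviation
   2s, which still has total mass 1. *)
have pdfle (x : R) : a < `|x| ->
    normal_pdf 0 s x <= 2 * expR (- y) * normal_pdf 0 (2 * s) x.
  move=> ax.
  rewrite (normal_pdfE _ (lt0r_neq0 s0)).
  rewrite (@normal_pdfE _ _ (2 * s)) ?lt0r_neq0 ?mulr_gt0 //.
  have -> : normal_peak s = 2 * normal_peak (2 * s).
    rewrite /normal_peak.
    have -> : (2 * s) ^+ 2 * pi *+ 2 = 2 ^+ 2 * (s ^+ 2 * pi *+ 2) by ring.
    by rewrite sqrtrM ?sqr_ge0 // sqrtr_sqr normr_nat invfM mulrA divff ?mul1r.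
  rewrite -!mulrA ler_pM2l // [leRHS]mulrCA ler_pM2l; last first.
    by rewrite normal_peak_gt0 ?lt0r_neq0 ?mulr_gt0.
  rewrite /normal_fun -expRD ler_expR subr0.
  have -> : - x ^+ 2 / (s ^+ 2 *+ 2) =
      - (3 * x ^+ 2 / (8 * s ^+ 2)) - x ^+ 2 / ((2 * s) ^+ 2 *+ 2).
    by field; lra.
  rewrite mulNr lerD2r lerN2 /y ler_pM2r ?invr_gt0 ?mulr_gt0 ?exprn_gt0 //.
  rewrite ler_pM2l // -[x ^+ 2]real_normK ?num_real //.
  by rewrite ler_sqr ?nnegrE // ltW.
have step : (normal_prob 0 s [set x | (a < `|x|)%R] <=
   (2 * expR (- y))%:E)%E.
  rewrite /normal_prob.
  apply: (@le_trans _ _ (\int[lebesgue_measure]_(x in [set x | (a < `|x|)%R])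
     ((2 * expR (- y))%:E * (normal_pdf 0 (2 * s) x)%:E))%E).
    apply: ge0_le_integral => //.
    - by move=> x _; rewrite lee_fin normal_pdf_ge0.
    - apply/measurable_EFinP; apply: measurable_funTS.
      exact: measurable_normal_pdf.
    - apply/measurable_EFinP; apply: measurable_funTS.
      by apply: measurable_funM => //; exact: measurable_normal_pdf.
  rewrite ge0_integralZl_EFin //; first last.
  - apply/measurable_EFinP; apply: measurable_funTS.
    exact: measurable_normal_pdf.
  - by move=> x _; rewrite lee_fin normal_pdf_ge0.
  rewrite -[leRHS]mule1 lee_pmul2l ?lte_fin ?mulr_gt0 ?expR_gt0 //.
  exact: (probability_le1 (normal_prob 0 (2 * s))).
apply: (le_trans step); rewrite lee_fin.
(* The quadratic Taylor term of [expR] gives the constant [2 * (128 / 9)], which is below 29. *)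
have y2 : y ^+ 2 / 2 <= expR y.
  by have := expR_ge1Dxn 1 (ltW y0); rewrite (_ : 2`!%:R = 2) //; lra.
have : expR (- y) <= (y ^+ 2 / 2)^-1.
  by rewrite expRN lef_pV2 ?posrE ?expR_gt0 // divr_gt0 ?exprn_gt0.
have -> : (y ^+ 2 / 2)^-1 = 128 / 9 * (s / a) ^+ 4 by rewrite /y; field; lra.
have : 0 <= (s / a) ^+ 4 by rewrite exprn_ge0 // divr_ge0 ?ltW.
lra.
Qed.

(** * Borel-Cantelli with geometric bounds, and dyadic chaining *)

Lemma nneseries_geometric_le (R : realType) (u : (\bar R)^nat) (c q : R) :
  0 <= c -> 0 < q < 1 -> (forall n, (0 <= u n <= (c * q ^+ n)%:E)%E) ->
  (\sum_(0 <= n <oo) u n <= (c / (1 - q))%:E)%E.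
Proof.
move=> c0 /andP[q0 q1] u_le.
apply: lime_le.
  by apply: is_cvg_nneseries => n _ _; have /andP[] := u_le n.
near=> n.
apply: (@le_trans _ _ (\sum_(0 <= i < n) (c * q ^+ i)%:E)%E).
  by apply: lee_sum => i _; have /andP[] := u_le i.
rewrite sumEFin lee_fin; apply: geometric_le_lim => //.
by rewrite ger0_norm // ltW.
Unshelve. all: by end_near. Qed.

Lemma borel_cantelli_geometric d (Omega : measurableType d) (R : realType)
    (mu : {measure set Omega -> \bar R}) (F : (set Omega)^nat) (c q : R) :
  0 <= c -> 0 < q < 1 -> (forall n, measurable (F n)) ->
  (forall n, (mu (F n) <= (c * q ^+ n)%:E)%E) ->
  {ae mu, forall w, \forall n \near \oo, ~ F n w}.
Proof.
move=> c0 q01 mF F_le.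
exists (lim_sup_set F); split.
- apply: bigcapT_measurable => n.
  by apply: bigcup_measurable.
- apply: lim_sup_set_cvg0 => //.
  apply: (@le_lt_trans _ _ (c / (1 - q))%:E); last exact: ltry.
  by apply: nneseries_geometric_le => // n; rewrite measure_ge0 F_le.
- move=> w /= nF n _.
  apply: contrapT => nFn; apply: nF; exists n => // m /= nm Fm.
  by apply: nFn; exists m.
Qed.

(** A point of level [k.+1] either belongs to level [k] (even index) or is the right neighbour of
    such a point (odd index), so each level adds at most one increment. Density of dyadic points and
    continuity extend the bound to all [x]. *)
Lemma dyadic_chaining (R : realType) (g : R -> R) (N A : R) (a : R^nat) :
  0 < N -> g 0 = 0 -> {within `[0, +oo[, continuous g} ->
  (forall k i, (i < 2 ^ k)%N ->
    `|g (N * i.+1%:R / 2 ^+ k) - g (N * i%:R / 2 ^+ k)| <= a k) ->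
  (forall k, \sum_(l < k) a l <= A) ->
  forall x, 0 <= x <= N -> `|g x| <= A.
Proof.
move=> N0 g0 /subspace_continuousP gc incr sumA x /andP[x0 xN].
have a_ge0 k : 0 <= a k.
  by apply: le_trans (incr k 0 _); rewrite ?normr_ge0 ?expn_gt0.
have dyadic k j : (j <= 2 ^ k)%N ->
    `|g (N * j%:R / 2 ^+ k)| <= \sum_(l < k.+1) a l.
  elim: k j => [|k IH] j.
    rewrite expn0 big_ord1 expr0 divr1; case: j => [|[|//]] _.
      by rewrite mulr0 g0 normr0.
    by have := incr 0%N 0%N isT; rewrite expr0 !divr1 mulr0 g0 subr0.
  have half (i : nat) : N * i.*2%:R / 2 ^+ k.+1 = N * i%:R / 2 ^+ k.
    by rewrite exprS -muln2 natrM; field; rewrite expf_neq0.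
  rewrite big_ord_recr /= -[j]odd_double_half expnS mul2n.
  have [oddj|_] := boolP (odd j); last first.
    by rewrite add0n leq_double half => /IH h; rewrite (le_trans h) // lerDl.
  rewrite add1n ltn_double => ij.
  rewrite -(subrK (g (N * (j./2).*2%:R / 2 ^+ k.+1)) (g _)) addrC.
  apply: (le_trans (ler_normD _ _)); apply: lerD.
    by apply: incr; rewrite expnS mul2n ltn_double.
  by rewrite half; apply/IH/ltnW.
(* [u k] is the last point of level [k] not exceeding [x], hence within [N / 2 ^ k] of [x]. *)
pose t k := Num.truncn (x / N * 2 ^+ k).
pose u k := N * (t k)%:R / 2 ^+ k.
have t_itv k : (t k)%:R <= x / N * 2 ^+ k < (t k).+1%:R.
  by apply: truncn_itv; rewrite mulr_ge0 ?exprn_ge0 // divr_ge0 // ltW.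
have p2 k : 0 < 2 ^+ k :> R by rewrite exprn_gt0.
have u_le k : u k <= x.
  have /andP[h _] := t_itv k; rewrite /u ler_pdivrMr // mulrC -ler_pdivlMr //.
  by rewrite mulrAC.
have u_ge k : x - N * 2^-1 ^+ k <= u k.
  have /andP[_ h] := t_itv k; rewrite /u lerBlDr exprVn -mulrDl.
  rewrite ler_pdivlMr // -[X in _ + X]mulr1 -mulrDr natr1 [leRHS]mulrC.
  by rewrite -ler_pdivrMr // mulrAC ltW.
have u_cvg : u @ \oo --> x.
  apply: (@squeeze_cvgr _ _ _ _ (fun k => x - N * 2^-1 ^+ k) (cst x)).
  - by near=> k; rewrite u_ge u_le.
  - rewrite -[X in _ --> X]subr0; apply: cvgB; first exact: cvg_cst.
    by apply: cvg_geometric; rewrite ger0_norm ?invr_ge0 // invf_lt1 ?ltr1n.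
  - exact: cvg_cst.
have gu_cvg : `|g (u k)| @[k --> \oo] --> `|g x|.
  apply: cvg_norm; apply: (cvg_comp u g); last first.
    by apply: gc => /=; rewrite in_itv /= x0.
  (* Continuity holds only within the half-line, so the limit of [u] is combined with [0 <= u k]. *)
  move=> V hV.
  apply: (@filterS _ \oo _ (fun k => `[0, +oo[%classic (u k) -> V (u k)) _ _
    (u_cvg _ hV)) => k; apply.
  by rewrite /= in_itv /= andbT /u divr_ge0 ?mulr_ge0 // ?ltW.
apply: (cvgr_to_le gu_cvg).
near=> k; apply: (le_trans (dyadic k (t k) _) (sumA _)).
rewrite -(ler_nat R) natrX; have /andP[h _] := t_itv k; apply: (le_trans h).
by rewrite ler_piMl ?exprn_ge0 // ler_pdivrMr // mul1r.
Unshelve. all: by end_near. Qed.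

(** * Linear growth of the subordinator *)

(** If the integral of the positive function [1 - expR (- x)] vanished, the half-line would be
    [nu]-null, against its infinite mass. *)
Lemma laplace_exponent1_gt0 (R : realType) (nu : {measure set R -> \bar R}) :
  infinite_levy_measure nu -> 0 < laplace_exponent nu 1.
Proof.
move=> [min_fin nuD].
set D : set R := `]0, +oo[%classic in min_fin nuD.
pose f (x : R) := 1 - expR (- (1 * x)).
have Dgt0 x : D x -> 0 < x by rewrite /D /= in_itv /= andbT.
have fx_gt0 x : D x -> 0 < f x.
  move=> /Dgt0 x0; rewrite /f mul1r subr_gt0 -expR0 ltr_expR.
  by rewrite oppr_lt0.
have f_ge0 x : D x -> 0 <= f x by move=> /fx_gt0/ltW.
have mf : measurable_fun D f.
  apply: measurable_funTS; apply: measurable_funB => //.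
  apply: measurableT_comp => //; apply: measurableT_comp => //.
have mD : measurable D by exact: measurable_itv.
(* The real-valued integral is [fine] of the extended one and would be 0 at infinity; finiteness
   comes from [1 - expR (- x) <= min 1 x]. *)
have f_fin : (\int[nu]_(x in D) (f x)%:E < +oo)%E.
  apply: le_lt_trans min_fin; apply: ge0_le_integral => //.
  - exact/measurable_EFinP.
  - apply/measurable_EFinP; apply: measurable_funTS.
    exact: measurable_minr.
  - move=> x Dx; rewrite lee_fin le_min; apply/andP; split.
      by rewrite lerBlDr lerDl expR_ge0.
    by rewrite /f mul1r; have := expR_ge1Dx (- x); lra.
have f_gt0 : (0 < \int[nu]_(x in D) (f x)%:E)%E.
  rewrite lt0e integral_ge0 ?andbT; last by move=> x Dx; rewrite lee_fin f_ge0.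
  apply/eqP => f0.
  have : (\int[nu]_(x in D) `|(f x)%:E| = 0)%E.
    rewrite -f0; apply: eq_integral => x /set_mem Dx.
    by rewrite gee0_abs // lee_fin f_ge0.
  have mEf : measurable_fun D (EFin \o f) by exact/measurable_EFinP.
  move=> /(ae_eq_integral_abs _ mD mEf).1 f_ae0.
  have : nu D = 0%E.
    apply: measure_negligible => //.
    apply: negligibleS f_ae0 => x Dx /= /(_ Dx) [].
    by apply/eqP; rewrite gt_eqF // fx_gt0.
  by rewrite nuD.
by rewrite /laplace_exponent /Rintegral fine_gt0 // f_gt0.
Qed.

(** Integer times are enough: with [n] the integer part of [t], the bound [n.+1] exceeds [t]. *)
Lemma subordinator_growth d (Omega : measurableType d) (R : realType)
    (P : probability Omega R) (nu : {measure set R -> \bar R})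
    (T : R -> {RV P >-> R}) :
  infinite_levy_measure nu -> subordinator nu T ->
  exists2 c, 0 < c &
    {ae P, forall w, \forall n \near \oo, n.+1%:R < T (c * n%:R) w}.
Proof.
move=> hnu hT; have f0 := laplace_exponent1_gt0 hnu.
set f := laplace_exponent nu 1 in f0.
have c0 : 0 < 2 / f by rewrite divr_gt0.
exists (2 / f) => //.
pose F n := [set w | T (2 / f * n%:R) w <= n.+1%:R].
suff : {ae P, forall w, \forall n \near \oo, ~ F n w}.
  apply: filterS => w; apply: filterS => n.
  by rewrite /F /= => /negP; rewrite -ltNge.
(* With [c = 2 / f] the Chernoff exponent [n + 1 - c * n * f] equals [1 - n]. *)
apply: (@borel_cantelli_geometric _ _ _ _ _ (expR 1) (expR (- 1))).
- exact: expR_ge0.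
- by rewrite expR_gt0 expR_lt1 /= oppr_lt0 ltr01.
- move=> n; rewrite /F -[X in measurable X]setTI.
  exact: measurable_fun_le.
- move=> n.
  (* Chernoff bounds upper tails; for the lower tail of [T] it is applied to [- T], whose moment
     generating function at 1 is the Laplace transform. *)
  pose X : {RV P >-> R} := (- T (2 / f * n%:R))%R.
  have -> : F n = [set w | - n.+1%:R <= X w].
    by apply/seteqP; split => w /=; rewrite lerN2.
  apply: (le_trans (chernoff X (- n.+1%:R) ltr01)).
  rewrite /mmt_gen_fun.
  have -> : (expR \o 1 \o* X) = fun w => expR (- (1 * T (2 / f * n%:R) w)).
    by apply/funext => w /=; rewrite mulr1 mul1r.
  rewrite (sub_laplace hT) ?(mulr_ge0 (ltW c0)) // -/f.
  rewrite -EFinM lee_fin -expRD.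
  rewrite -expRM_natl -expRD ler_expR mul1r opprK -natr1.
  by rewrite mulrAC divfK ?gt_eqF //; lra.
Qed.

(** * Growth of Brownian motion *)

Lemma brownian_increment_tail d (Omega : measurableType d) (R : realType)
    (P : probability Omega R) (B : R -> {RV P >-> R}) (s t a : R) :
  standard_brownian_motion B -> 0 <= s -> s < t -> 0 < a ->
  (P [set w | (a < `|B t w - B s w|)%R] <= (29 * (t - s) ^+ 2 / a ^+ 4)%:E)%E.
Proof.
move=> hB s0 st a0.
rewrite (bm_gauss hB s0 st (measurable_gt_norm a)).
apply: le_trans (normal_tail _ a0) _; first by rewrite sqrtr_gt0 subr_gt0.
rewrite lee_fin expr_div_n (exprM _ 2 2) sqr_sqrtr ?mulrA //.
by rewrite subr_ge0 ltW.
Qed.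

Section brownian_growth.
Context {d : measure_display} {Omega : measurableType d} {R : realType}.
Variables (P : probability Omega R) (B : R -> {RV P >-> R}).
Hypothesis hB : standard_brownian_motion B.

Let increment (m k i : nat) (w : Omega) : R :=
  B (2 ^+ m * i.+1%:R / 2 ^+ k) w - B (2 ^+ m * i%:R / 2 ^+ k) w.

(* In place of 3/2 and 9/10 any rho and r with 4 < rho^4 < 16 and 1/2 < r^4 < 1
   would do: the union bound at level k is of order (4/rho^4)^m (1/(2r^4))^k. *)
Let threshold (m k : nat) : R := (3 / 2) ^+ m * (9 / 10) ^+ k.

Let large (m k i : nat) : set Omega :=
  [set w | threshold m k < `|increment m k i w|].

Let measurable_large m k i : measurable (large m k i).
Proof.
rewrite -[X in measurable X]setTI.
have mf : measurable_fun setT (increment m k i) by apply: measurable_funB.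
exact: mf measurableT _ (measurable_gt_norm (threshold m k)).
Qed.

(** The factor [1 / 2 ^ k] is kept apart to cancel the [2 ^ k] intervals in the union bound at level
    [k]. *)
Let prob_large m k i :
  (P (large m k i) <=
    (29 * (64 / 81) ^+ m * (5000 / 6561) ^+ k / 2 ^+ k)%:E)%E.
Proof.
have p2 n : 0 < 2 ^+ n :> R by rewrite exprn_gt0.
apply: le_trans (brownian_increment_tail hB _ _ _) _.
- by rewrite divr_ge0 ?mulr_ge0 // ltW.
- by rewrite ltr_pM2r ?invr_gt0 // ltr_pM2l // ltr_nat.
- by rewrite /threshold mulr_gt0 ?exprn_gt0.
have -> : 2 ^+ m * i.+1%:R / 2 ^+ k - 2 ^+ m * i%:R / 2 ^+ k =
    2 ^+ m / 2 ^+ k :> R by rewrite -natr1; ring.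
rewrite lee_fin le_eqVlt; apply/orP; left; apply/eqP.
rewrite /threshold.
have -> : (64 / 81 : R) = 2 ^+ 2 / (3 / 2) ^+ 4 by field.
have -> : (5000 / 6561 : R) = 2^-1 / (9 / 10) ^+ 4 by field.
rewrite !expr_div_n !exprVn -!exprM ![(_ * m)%N]mulnC ![(_ * k)%N]mulnC !exprM.
by field; rewrite !expf_neq0 // ?pnatr_eq0.
Qed.

Let prob_level m k :
  (P (\big[setU/set0]_(i < 2 ^ k) large m k i) <=
    (29 * (64 / 81) ^+ m * (5000 / 6561) ^+ k)%:E)%E.
Proof.
apply: (le_trans (Boole_inequality _ _)) => //.
apply: (@le_trans _ _ (\sum_(i < 2 ^ k)
  (29 * (64 / 81) ^+ m * (5000 / 6561) ^+ k / 2 ^+ k : R)%:E)%E).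
  by apply: lee_sum => i _; exact: prob_large.
rewrite sumEFin lee_fin big_const_ord iter_addr_0 -[_ *+ (2 ^ k)%N]mulr_natr.
by rewrite natrX divfK ?expf_neq0.
Qed.

Lemma brownian_growth :
  {ae P, forall w, \forall m \near \oo,
    forall x, 0 <= x <= 2 ^+ m -> `|B x w| <= 10 * (3 / 2) ^+ m}.
Proof.
pose level m k := \big[setU/set0]_(i < 2 ^ k) large m k i.
have mlevel m k : measurable (level m k) by exact: bigsetU_measurable.
have : {ae P, forall w, \forall m \near \oo, ~ (\bigcup_k level m k) w}.
  (* Summing over the levels [k] at fixed [m] gives this constant times [(64 / 81) ^ m], to which
     Borel-Cantelli in [m] applies. *)
  have c0 : 0 <= 29 / (1 - 5000 / 6561) :> R.
    by apply: divr_ge0; [exact: ler0n|lra].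
  have q01 : 0 < (64 / 81 : R) < 1 by lra.
  apply: (borel_cantelli_geometric c0 q01).
    by move=> m; exact: bigcup_measurable.
  move=> m; apply: (le_trans (generalized_Boole_inequality _ _ _)) => //.
    exact: bigcup_measurable.
  rewrite mulrAC; apply: nneseries_geometric_le; [|lra|].
    by rewrite mulr_ge0 // exprn_ge0.
  by move=> k; rewrite measure_ge0 prob_level.
move=> ae_level; near=> w.
have B0 : B 0 w = 0 by near: w; exact: (bm_start hB).
have Bc : {within `[0, +oo[, continuous (fun t : R => B t w)}.
  by near: w; exact: (bm_cont hB).
have : \forall m \near \oo, ~ (\bigcup_k level m k) w by near: w.
apply: filterS => m small x x_itv.
apply: (@dyadic_chaining _ _ _ _ (threshold m) _ B0 Bc _ _ _ x_itv).
- by rewrite exprn_gt0.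
- move=> k i ik; rewrite leNgt; apply/negP => big; apply: small.
  by exists k => //; rewrite /level -bigcup_mkord; exists i.
- move=> k; rewrite -(big_mkord xpredT (threshold m)) /threshold.
  (* The constant 10 is the sum of the geometric series of ratio [9 / 10]. *)
  have -> : 10 * (3 / 2) ^+ m = (3 / 2) ^+ m / (1 - 9 / 10) :> R.
    by field.
  apply: geometric_le_lim; [by rewrite exprn_ge0|lra|].
  by rewrite ger0_norm; lra.
Unshelve. all: by end_near. Qed.

End brownian_growth.

(** * Sublinearity and the limit *)

Lemma sublinear_running_max (R : realType) (g : R -> R) (K : R) :
  (\forall m \near \oo,
    forall x, 0 <= x <= 2 ^+ m -> `|g x| <= K * (3 / 2) ^+ m) ->
  forall e, 0 < e ->
    \forall x \near +oo, forall s, 0 <= s <= x -> `|g s| <= e * x.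
Proof.
move=> [M1 _ hM1] e e0.
(* The ratio of the bound at scale [2 ^ m.+1] to [2 ^ m]; below, [m] is chosen with
   [2 ^ m <= x < 2 ^ m.+1]. *)
have /cvgr0_norm_le/(_ _ e0)[M2 _ hM2] :
    geometric (K * (3 / 2)) (3 / 4 : R) n @[n --> \oo] --> (0 : R).
  by apply: cvg_geometric; rewrite ger0_norm; lra.
near=> x.
have x_ge : (2 ^ maxn M1 M2)%:R <= x by near: x; exact: nbhs_pinfty_ge.
have x0 : 0 <= x by apply: le_trans x_ge.
have /andP[t_le t_gt] := truncn_itv x0.
have t_ge : (2 ^ maxn M1 M2 <= Num.truncn x)%N.
  by rewrite -ltnS -(ltr_nat R); exact: le_lt_trans t_gt.
have t0 : (0 < Num.truncn x)%N by rewrite (leq_trans _ t_ge) ?expn_gt0.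
have /andP[m_le m_gt] := trunc_log_bounds (ltnSn 1) t0.
set m := trunc_log 2 _ in m_le m_gt.
have m_ge : (maxn M1 M2 <= m)%N by exact: trunc_log_max.
move: m_ge; rewrite geq_max => /andP[M1m M2m].
move=> s /andP[s0 sx].
apply: (@le_trans _ _ (K * (3 / 2) ^+ m.+1)).
  apply: hM1; first exact: leqW.
  rewrite s0 (le_trans sx) // -natrX (le_trans (ltW t_gt)) // ler_nat.
  exact: m_gt.
apply: (@le_trans _ _ (e * 2 ^+ m)); last first.
  by rewrite ler_pM2l // (le_trans _ t_le) // -natrX ler_nat.
have := hM2 m M2m; rewrite /geometric /= => /(le_trans (ler_norm _)) h.
rewrite -ler_pdivrMr ?exprn_gt0 //; apply: le_trans h.
have -> : 3 / 4 = 3 / 2 / 2 :> R by field.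
by rewrite [(3 / 2 / 2) ^+ m]expr_div_n exprS !mulrA.
Unshelve. all: by end_near. Qed.

Theorem theorem3 (d : measure_display) (Omega : measurableType d)
    (R : realType) (P : probability Omega R)
    (nu : {measure set R -> \bar R}) (T B : R -> {RV P >-> R})
    (hnu : infinite_levy_measure nu)
    (hT : subordinator nu T)
    (hB : standard_brownian_motion B)
    (hBS : independent_processes P B (inverse_process T)) :
  {ae P, forall w, B (inverse_process T t w) w / t @[t --> +oo] --> (0 : R)}.
Proof.
have [c c0 T_growth] := subordinator_growth hnu hT.
have B_growth := brownian_growth hB.
near=> w.
have [M _ hM] : \forall n \near \oo, n.+1%:R < T (c * n%:R) w by near: w.
have /sublinear_running_max Bw : \forall m \near \oo, forall x : R,
  0 <= x <= 2 ^+ m -> `|B x w| <= 10 * (3 / 2) ^+ m by near: w.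
(* On a bounded path the set may be empty; its [inf] is then 0 by convention. *)
have S_ge0 t : 0 <= inverse_process T t w.
  rewrite /inverse_process; set E := [set _ | _].
  have [->|/set0P E0] := eqVneq E set0; first by rewrite inf0.
  by apply: lb_le_inf => // x [/ltW].
apply/cvgr0Pnorm_le => e e0.
(* Tolerance [e / c] at the point [c * t] yields exactly [e * t]. A running maximum is needed since
   only [S(t) <= c * t] is known. *)
have [x0 [_ hx0]] := Bw _ (divr_gt0 e0 c0).
near=> t.
have t_gt0 : 0 < t by near: t; exact: nbhs_pinfty_gt.
have S_le : inverse_process T t w <= c * t.
  have t_ge : M.+1%:R <= t by near: t; exact: nbhs_pinfty_ge.
  have /andP[n_le n_gt] := truncn_itv (ltW t_gt0).
  (* Strictness makes the integer part positive, so [c * n] is an admissible [tau] in the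
     infimum. *)
  have n_ge : (M < Num.truncn t)%N.
    by rewrite -ltnS -(ltr_nat R); exact: le_lt_trans n_gt.
  apply: (@le_trans _ _ (c * (Num.truncn t)%:R)); last by rewrite ler_pM2l.
  apply: ge_inf; first by exists 0 => x [/ltW].
  split; first by rewrite mulr_gt0 // ltr0n (leq_trans _ n_ge).
  by apply: lt_trans n_gt _; apply: hM => /=; exact: ltnW.
rewrite normrM normfV (gtr0_norm t_gt0) ler_pdivrMr //.
have -> : e * t = e / c * (c * t) by rewrite mulrA divfK ?gt_eqF.
apply: hx0; last by rewrite S_ge0 S_le.
rewrite mulrC -ltr_pdivrMr //; near: t.
by apply: nbhs_pinfty_gt; exact: num_real.
Unshelve. all: by end_near. Qed.
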